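(* Suppose $\mathcal{I}$ is a subgroup of $\mathrm{Sym}(n)$ such that it is an independent set of $G(\Omega_n)$. Then $$\omega(n)\le n!/|\mathcal{I}|.$$ In particular, if $n=2k$ is an even number, then $$\omega(n)\le \frac{(2k)!}{k!\,2^{k-1}}.$$
   Context: $\mathrm{Sym}(n)$ is the symmetric group on $\{1,\dots,n\}$. The Birkhoff polytope graph $G(\Omega_n)$ has vertex set $\mathrm{Sym}(n)$, and $\sigma_1,\sigma_2$ are adjacent iff $\sigma_1^{-1}\sigma_2$ is a single cycle of length $>1$ (a permutation whose disjoint cycle decomposition has exactly one nontrivial cycle). An independent set is a set of pairwise nonadjacent vertices. $\omega(n)$ denotes the clique number of $G(\Omega_n)$, i.e. the maximum size of a set of pairwise adjacent vertices. *)

(* Defs.v *)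
From mathcomp Require Import all_boot all_order all_algebra all_fingroup.

Set Implicit Arguments.
Unset Strict Implicit.
Unset Printing Implicit Defensive.

Definition single_cycle (T : finType) (s : {perm T}) : bool :=
  #|[set c in porbits s | 1 < #|c|]| == 1.

(* MathComp composes permutations left to right, so [s^-1 * t] is the map
   t o s^-1, whereas it is s^-1 o t in the right-to-left convention.  These two
   maps are conjugate by s, hence have the same cycle type, and both readings
   define the same graph. *)
Definition birkhoff_adj (n : nat) : rel {perm 'I_n} :=
  fun s t => single_cycle (s^-1 * t)%g.

Definition is_clique (V : finType) (e : rel V) (A : {set V}) : bool :=
  [forall x in A, forall y in A, (x != y) ==> e x y].

Definition is_independent (V : finType) (e : rel V) (A : {set V}) : bool :=
  [forall x in A, forall y in A, (x != y) ==> ~~ e x y].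

Definition clique_number (V : finType) (e : rel V) : nat :=
  \max_(A : {set V} | is_clique e A) #|A|.

Definition omega (n : nat) : nat := clique_number (@birkhoff_adj n).

(* Main.v *)
Require Import Defs.
From mathcomp Require Import all_boot all_order all_algebra all_fingroup.
From mathcomp Require Import cyclic pgroup sylow alt.

(** The graph is a Cayley graph: adjacency of [s] and [t] depends only on
    [s^-1 * t].  Hence if a subgroup [I] is independent, two distinct members
    of a clique cannot lie in the same left coset of [I], and a clique has at
    most as many elements as [I] has left cosets ([card_clique_lcosets]).

    For [n = 2k] the bound is applied to [I = 'C[t] :&: 'Alt_T], where [t] is a
    fixed-point-free involution.  If [s] in [I] were a single cycle, then [s]
    being even its unique nontrivial orbit would have odd size
    ([odd_perm_single_orbit]); but [t] commutes with [s], so it would preserve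
    this orbit and pair off its points, making the size even
    ([even_card_fpf_stable]).  Thus [I] is independent.  Its order is large
    enough because ['C[t]] contains the [k! * 2 ^ k] signed permutations of the
    [k] pairs exchanged by [t], and the even elements of a permutation group
    make up at least half of it.  (Abstractly, ['C[t]] is the Weyl group of
    type B_k, and [I] the one of type D_k.) *)

Set Implicit Arguments.
Unset Strict Implicit.
Unset Printing Implicit Defensive.

Import Order.TTheory GRing.Theory Num.Theory.

(** * Cliques against independent subgroups *)

Section CayleyGraph.
Local Open Scope group_scope.

Lemma card_clique_lcosets (gT : finGroupType) (P : pred gT) (A : {set gT})
    (I : {group gT}) :
  let e := fun x y => P (x^-1 * y) in
  is_clique e A -> is_independent e I -> #|A| <= #|[set: gT] : I|.
Proof.
move=> e /forall_inP clA /forall_inP indI.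
have injA : {in A &, injective (lcoset I)}.
  move=> a b Aa Ab; rewrite !lcosetE => eqI; apply/eqP; apply: contraT => neq_ab.
  have Iab : a^-1 * b \in I by rewrite -mem_lcoset eqI lcoset_refl.
  (* By translation by [a^-1], the edge [a -- b] becomes an edge of [I]. *)
  have /forall_inP/(_ _ Iab)/implyP := indI _ (group1 I).
  rewrite /e invg1 mul1g eq_sym -eq_mulVg1 neq_ab => /(_ isT).
  by have /forall_inP/(_ _ Ab)/implyP/(_ neq_ab) := clA _ Aa; rewrite /e => ->.
rewrite -card_lcosets -(card_in_imset injA) subset_leq_card //.
by apply/subsetP=> _ /imsetP[a _ ->]; rewrite imset_f ?inE.
Qed.

End CayleyGraph.

Lemma omega_mul_independent n (I : {group {perm 'I_n}}) :
  is_independent (@birkhoff_adj n) I -> omega n * #|I| <= n`!.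
Proof.
move=> indI; rewrite -card_Sn -cardsT -(Lagrange (subsetT I)) mulnC.
rewrite leq_pmul2l ?cardG_gt0 //; apply/bigmax_leqP => A clA.
exact: card_clique_lcosets clA indI.
Qed.

(** * Single cycles centralising a fixed-point-free involution *)

Section PermParity.
Local Open Scope group_scope.
Variable T : finType.
Implicit Types (s t : {perm T}) (c : {set T}).

(** A permutation commuting with [s] carries orbits of [s] onto orbits of [s]. *)
Lemma card_porbit_commute s t x :
  commute s t -> #|porbit s (t x)| = #|porbit s x|.
Proof.
move=> cst; rewrite -(card_imset (porbit s x) (@perm_inj _ t)).
apply: eq_card => y.
have stE i : (s ^+ i) (t x) = t ((s ^+ i) x).
  by rewrite -!permM; congr (fun_of_perm _ x); exact/commuteX/commute_sym.
apply/porbitP/imsetP => [[i ->]|[_ /porbitP[i ->] ->]].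
  by exists ((s ^+ i) x); rewrite ?mem_porbit.
by exists i.
Qed.

(** All other orbits being points, [#|T| - #|porbits s|] is [#|c| - 1]. *)
Lemma odd_perm_single_orbit s c :
  [set b in porbits s | 1 < #|b|] = [set c] -> odd_perm s = ~~ odd #|c|.
Proof.
move=> single; have : c \in [set b in porbits s | 1 < #|b|].
  by rewrite single set11.
rewrite inE => /andP[sc _].
have parP : partition (porbits s) [set: T].
  have actsT : [acts <[s]>, on [set: T] | 'P].
    by apply/actsP=> a _ x; rewrite !inE.
  have -> : porbits s = orbit 'P <[s]> @: [set: T].
    rewrite /porbits porbitE; apply/setP=> b.
    by apply/imsetP/imsetP=> -[x _ ->]; exists x; rewrite ?inE.
  exact: orbit_partition.
have cardT : #|T| = (#|c| + #|porbits s :\ c|)%N.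
  rewrite -cardsT (card_partition parP) (big_setD1 c) //=.
  rewrite -(sum1_card (mem (_ :\ c))).
  congr (_ + _)%N; apply: eq_bigr => b /setD1P[neq_bc sb].
  have : b \notin [set b in porbits s | 1 < #|b|] by rewrite single inE.
  rewrite inE sb -leqNgt => b_le1; apply/eqP; rewrite eqn_leq b_le1 /=.
  by have /imsetP[x _ ->] := sb; rewrite lt0n card_porbit_neq0.
rewrite /odd_perm cardT (cardsD1 c (porbits s)) sc !oddD.
by case: (odd #|c|); case: odd.
Qed.

(** The 2-group [<[t]>] acts on [c] without fixed points. *)
Lemma even_card_fpf_stable t c :
  t * t = 1 -> (forall x, t x != x) -> (forall x, x \in c -> t x \in c) ->
  ~~ odd #|c|.
Proof.
move=> tt fpf stab.
have p2 : 2.-group <[t]>.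
  apply: (@pnat_dvd _ 2) => //.
  by rewrite [_ %| _]order_dvdn expgS expg1 tt.
have acts_c : [acts <[t]>, on c | 'P].
  by rewrite cycle_subG !inE; apply/subsetP=> x /stab; rewrite inE.
have := pgroup_fix_mod p2 acts_c.
suff -> : 'Fix_(c | 'P)(<[t]>) = set0.
  by rewrite cards0 !modn2; case: (odd _).
apply/setP=> x; rewrite in_set0 afix_cycle_in ?inE //.
apply/negP=> /andP[_]; rewrite sub1set inE => /eqP tx.
by have := fpf x; rewrite -{2}tx eqxx.
Qed.

(** An even cycle has odd length, whereas the orbit it moves would be stable
    under [t], hence of even size. *)
Lemma even_centraliser_not_single_cycle s t :
  t * t = 1 -> (forall x, t x != x) -> commute s t -> ~~ odd_perm s ->
  ~~ single_cycle s.
Proof.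
move=> tt fpf cst even_s; apply/negP=> /cards1P[c single].
move: even_s; rewrite (odd_perm_single_orbit single) negbK; apply/negP.
apply: even_card_fpf_stable tt fpf _ => x xc.
have orbE b : (b \in porbits s) && (1 < #|b|) = (b == c).
  by have /setP/(_ b) := single; rewrite !inE.
have /andP[/imsetP[y _ defc] c_gt1] : (c \in porbits s) && (1 < #|c|).
  by rewrite orbE.
have defx : porbit s x = c by apply/eqP; rewrite defc eq_porbit_mem -defc.
(* [porbit s (t x)] is again a nontrivial orbit, and [c] is the only one. *)
have /eqP <- : porbit s (t x) == c.
  by rewrite -orbE imset_f //= (card_porbit_commute x cst) defx.
exact: porbit_id.
Qed.

(** ['Alt_T] is the kernel of the sign, which takes at most two values on [G].
    Stated as an inequality, this also covers the groups without odd elements,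
    in particular the degenerate case of an empty [T]. *)
Lemma card_even_subgroup (G : {group {perm T}}) :
  #|G| <= 2 * #|G :&: 'Alt_T|.
Proof.
rewrite -(LagrangeI G 'Alt_T) mulnC leq_mul2r; apply/orP; right.
have := card_morphim [morphism of @odd_perm T] G; rewrite setTI => <-.
by rewrite -card_bool max_card.
Qed.

(** Being a group, ['C[t] :&: 'Alt_T] contains all its quotients [s^-1 * s'], so
    only its elements need to be tested. *)
Lemma independent_even_centraliser t :
  t * t = 1 -> (forall x, t x != x) ->
  is_independent (fun s s' => single_cycle (s^-1 * s')) ('C[t] :&: 'Alt_T).
Proof.
move=> tt fpf; apply/forall_inP=> x Ix; apply/forall_inP=> y Iy.
apply/implyP=> _.
have : x^-1 * y \in 'C[t] :&: 'Alt_T by rewrite groupM ?groupV.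
rewrite in_setI Alt_even => /andP[/cent1P cxy even_xy].
exact: even_centraliser_not_single_cycle tt fpf cxy even_xy.
Qed.

End PermParity.

(** * Signed permutations *)

Section SignedPermutations.
Local Open Scope group_scope.
Variable J : finType.

Lemma flip_inj : injective (fun q : J * bool => (q.1, ~~ q.2)).
Proof. by move=> [i b] [j d] /= [-> /negb_inj->]. Qed.

Definition flip : {perm J * bool} := perm flip_inj.

Lemma signed_perm_inj (f : {ffun J -> bool}) (p : {perm J}) :
  injective (fun q : J * bool => (p q.1, q.2 (+) f q.1)).
Proof. by move=> [i b] [j d] /= [/perm_inj-> /addIb->]. Qed.

(** The pairs [{(i, false), (i, true)}] are permuted by [u.2], and the one with
    index [i] is reversed along the way when [u.1 i] holds. *)
Definition signed_perm (u : {ffun J -> bool} * {perm J}) : {perm J * bool} :=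
  perm (@signed_perm_inj u.1 u.2).

Lemma flipK : flip * flip = 1.
Proof. by apply/permP=> -[i b]; rewrite permM !permE /= negbK. Qed.

Lemma flip_fpf q : flip q != q.
Proof. by case: q => i b; rewrite permE /= xpair_eqE eqxx; case: b. Qed.

Lemma signed_perm_flip u : commute (signed_perm u) flip.
Proof. by apply/permP=> -[i b]; rewrite !permM !permE /= addNb. Qed.

Lemma injective_signed_perm : injective signed_perm.
Proof.
move=> [f p] [g r] /permP eq_fg.
have eqE i : p i = r i /\ f i = g i.
  by have := eq_fg (i, false); rewrite !permE /= => -[].
by congr (_, _); [apply/ffunP | apply/permP] => i; case: (eqE i).
Qed.

Lemma card_cent_flip : #|J|`! * 2 ^ #|J| <= #|'C[flip]|.
Proof.
have -> : (#|J|`! * 2 ^ #|J|)%N = #|[set: {ffun J -> bool} * {perm J}]|.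
  rewrite cardsT card_prod card_ffun card_bool mulnC; congr (_ * _)%N.
  rewrite -cardsT -card_perm; apply: eq_card => p; rewrite inE unfold_in.
  by apply/subsetP=> x; rewrite inE.
rewrite -(card_imset _ injective_signed_perm) subset_leq_card //.
by apply/subsetP=> _ /imsetP[u _ ->]; apply/cent1P/signed_perm_flip.
Qed.

End SignedPermutations.

(** * Transport along a bijection *)

Section Transport.
Local Open Scope group_scope.
Variables (X T : finType) (h : X -> T) (h' : T -> X).
Hypotheses (hK : cancel h h') (h'K : cancel h' h).

Lemma transport_inj (g : {perm X}) : injective (fun x => h (g (h' x))).
Proof. by move=> x y /(can_inj hK)/perm_inj/(can_inj h'K). Qed.

(** The isomorphism of symmetric groups induced by [h]; it moves [flip] from
    ['I_k * bool], where signed permutations have a simple formula, to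
    ['I_(2 * k)]. *)
Definition transport (g : {perm X}) : {perm T} := perm (@transport_inj g).

Lemma transportM g1 g2 : transport (g1 * g2) = transport g1 * transport g2.
Proof. by apply/permP=> x; rewrite permM !permE /= hK. Qed.

Lemma injective_transport : injective transport.
Proof.
move=> g1 g2 /permP eq_g; apply/permP=> x.
by have := eq_g (h x); rewrite !permE hK => /(can_inj hK).
Qed.

Lemma card_cent_transport g : #|'C[g]| <= #|'C[transport g]|.
Proof.
rewrite -(card_imset _ injective_transport) subset_leq_card //.
apply/subsetP=> _ /imsetP[u /cent1P cu ->]; apply/cent1P.
by rewrite /commute -!transportM cu.
Qed.

End Transport.

(** The factor [2] is kept on the right because for [k = 0] the order [1] of [I]
    exceeds [k! * 2 ^ (k - 1)], which is then not an integer. *)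
Lemma exists_independent_subgroup k :
  exists2 I : {group {perm 'I_(2 * k)}},
    is_independent (@birkhoff_adj (2 * k)) I & k`! * 2 ^ k <= 2 * #|I|.
Proof.
have cardX : #|{: 'I_k * bool}| = #|'I_(2 * k)|.
  by rewrite card_prod card_bool !card_ord mulnC.
pose h (q : 'I_k * bool) : 'I_(2 * k) :=
  enum_val (cast_ord cardX (enum_rank q)).
pose h' (x : 'I_(2 * k)) : 'I_k * bool :=
  enum_val (cast_ord (esym cardX) (enum_rank x)).
have hK : cancel h h' by move=> q; rewrite /h' enum_valK cast_ordK enum_rankK.
have h'K : cancel h' h by move=> x; rewrite /h enum_valK cast_ordKV enum_rankK.
pose t := transport hK h'K (flip 'I_k).
have tt : (t * t = 1)%g.
  by rewrite -transportM flipK; apply/permP=> x; rewrite permE !perm1 h'K.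
have fpf x : t x != x.
  by rewrite permE -{2}(h'K x) (can_eq hK) flip_fpf.
exists ('C[t] :&: 'Alt_('I_(2 * k)))%G.
  exact: independent_even_centraliser tt fpf.
apply: leq_trans (card_even_subgroup _).
apply: leq_trans (card_cent_transport hK h'K _).
by have := card_cent_flip 'I_k; rewrite card_ord.
Qed.

Local Open Scope ring_scope.

Theorem theorem2p10 :
  (forall (n : nat) (I : {group {perm 'I_n}}),
     is_independent (@birkhoff_adj n) I ->
     (omega n)%:R <= (n`!)%:R / #|I|%:R :> rat) /\
  (forall (n k : nat), n = (2 * k)%N ->
     (omega n)%:R <= ((2 * k)`!)%:R / ((k`!)%:R * 2 ^ (k%:Z - 1)) :> rat).
Proof.
have part1 n (I : {group {perm 'I_n}}) : is_independent (@birkhoff_adj n) I ->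
    (omega n)%:R <= (n`!)%:R / #|I|%:R :> rat.
  move=> indI; rewrite ler_pdivlMr ?ltr0n ?cardG_gt0 // -natrM ler_nat.
  exact: omega_mul_independent.
split=> // n k ->; have [I indI cardI] := exists_independent_subgroup k.
apply: le_trans (part1 _ _ indI) _; rewrite ler_pM2l ?ltr0n ?fact_gt0 //.
rewrite lef_pV2 ?posrE ?mulr_gt0 ?exprz_gt0 ?ltr0n ?fact_gt0 ?cardG_gt0 //.
(* Splitting off the exponent [-1] keeps the case [k = 0] uniform. *)
rewrite expfzDr // mulrA ler_pdivrMr // -exprnP -natrX -!natrM ler_nat mulnC.
by rewrite [X in (_ <= X)%N]mulnC [X in (X <= _)%N]mulnC.
Qed.
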